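(* Let $S$ be a unitary $2\times2$ complex matrix, $Q=\begin{pmatrix}0&0\\0&1\end{pmatrix}$, and on $\mathcal{H}=L^2(\mathbb{R};\mathbb{C}^2)$ let $Q(t)=U(t)^*QU(t)$, where $$(U(t)\psi)(x)=\begin{cases}\psi(x-t)+(S-1)\,\theta(0<x<t)\,\psi(x-t), & t>0,\\ \psi(x-t)+(S^*-1)\,\theta(t<x<0)\,\psi(x-t), & t<0.\end{cases}$$ Let $I(t)=\frac{dQ(t)}{dt}=I_+(t)+I_-(t)$ with outgoing and incoming parts $$I_+(t)=\big(S^*QS\,\theta(-x)+Q\,\theta(x)\big)\delta(x+t),\qquad I_-(t)=-\big(Q\,\theta(-x)+SQS^*\,\theta(x)\big)\delta(x+t).$$ Then for every $k\ge1$, as operator-valued distributions in $(t_1,\dots,t_k)$, $$\mathrm{T}^*\big(I(t_1)\cdots I(t_k)\big)=\widetilde{\mathrm{T}}\big(I(t_1)\cdots I(t_k)\big).$$ Here $\mathrm{T}^*(I(t_1)\cdots I(t_k)):=\frac{\partial}{\partial t_k}\cdots\frac{\partial}{\partial t_1}\mathrm{T}(Q(t_1)\cdots Q(t_k))$. The ordering $\widetilde{\mathrm{T}}$ places any $I_-(t)$ to the right of any $I_+(t')$, regardless of whether $t>t'$ or $t<t'$ (the order of currents of the same type is irrelevant), and extends by linearity to $I(t)=I_+(t)+I_-(t)$.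
   Context: $\theta(\text{condition})$ is the indicator function of the condition, $\theta(x)$ is the Heaviside step function, and functions of $x$ act on $\mathcal{H}$ by multiplication, while $2\times2$ matrices act on the $\mathbb{C}^2$ factor. $\mathrm{T}$ is the usual time ordering, i.e. $\mathrm{T}(Q(t_1)\cdots Q(t_k))$ is the product of the $Q(t_i)$ arranged so that those with later times stand to the left. The derivatives defining $\mathrm{T}^*$ are taken after the time ordering, in the sense of distributions in $(t_1,\dots,t_k)$. The operator $Q(t)$ is multiplication by the matrix-valued function $$\big(Q\,\theta(-x-t)+S^*QS\,\theta(x+t)\big)\theta(-x)+\big(SQS^*\,\theta(-x-t)+Q\,\theta(x+t)\big)\theta(x).$$ The currents $I(t),I_\pm(t)$ are operator-valued distributions in $t$: for a test function $\varphi$, $\int\varphi(t)I_+(t)\,dt$ is multiplication by $\big(S^*QS\,\theta(-x)+Q\,\theta(x)\big)\varphi(-x)$, and similarly for $I_-$. One has $[I_\pm(t),I_\pm(s)]=0$. Products such as $I_+(t_1)I_-(t_2)$ are distributions in $(t_1,t_2)$, defined on product test functions by the product of the corresponding operators. *)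

(* Defs.v *)
From HB Require Import structures.
From mathcomp Require Import all_boot all_order all_algebra.
From mathcomp Require Import all_classical all_reals all_analysis.
From mathcomp Require Import complex.

Set Implicit Arguments.
Unset Strict Implicit.
Unset Printing Implicit Defensive.

Import Order.TTheory GRing.Theory Num.Theory.
Import numFieldNormedType.Exports.

Local Open Scope classical_set_scope.
Local Open Scope ring_scope.
Local Open Scope complex_scope.
Local Open Scope sesquilinear_scope.

(* Lebesgue measure on R^k, realized on k-tuples as the image of the product
   of the one-dimensional measure and the measure on R^(k-1).               *)
Section LebesgueTuple.
Variable R : realType.
Local Notation mR := (measurableTypeR R).

Definition tcons (n : nat) (p : mR * n.-tuple mR) : n.+1.-tuple mR :=
  [tuple of p.1 :: p.2].

Lemma measurable_tcons (n : nat) : measurable_fun setT (@tcons n).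
Proof. exact: (measurable_cons measurable_fst measurable_snd). Qed.

Definition tuncons (n : nat) (t : n.+1.-tuple mR) : mR * n.-tuple mR :=
  (tnth t ord0, [tuple of behead t]).

Lemma measurable_tuncons (n : nat) : measurable_fun setT (@tuncons n).
Proof.
apply/measurable_fun_pairP; split; first exact: measurable_tnth.
exact: measurable_behead.
Qed.

Lemma tconsK (n : nat) : cancel (@tcons n) (@tuncons n).
Proof. by move=> [x t]; congr pair; apply: val_inj. Qed.

Section TconsMeasure.
Variables (n : nat) (mu : {sigma_finite_measure set (n.-tuple mR) -> \bar R}).

Definition tcons_measure : set (n.+1.-tuple mR) -> \bar R :=
  pushforward (lebesgue_measure \x mu)%E (@tcons n).

HB.instance Definition _ := Measure.copy tcons_measure
  (@measure_function_pushforward__canonical__measure_function_Measure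
     _ _ _ _ _ (lebesgue_measure \x mu)%E _ (@measurable_tcons n)).

Lemma tcons_measure_sigma_finite : sigma_finite setT tcons_measure.
Proof.
have /sigma_finiteP[F [FT Fnd Foo]] := sigma_finiteT (@lebesgue_measure R).
have /sigma_finiteP[G [GT Gnd Goo]] := sigma_finiteT mu.
exists (fun i => @tuncons n @^-1` (F i `*` G i)).
  rewrite -preimage_bigcup; apply/esym/seteqP; split=> // t _ /=.
  have [i _ Fi] : (\bigcup_i F i) (tuncons t).1 by rewrite -FT.
  have [j _ Gj] : (\bigcup_i G i) (tuncons t).2 by rewrite -GT.
  exists (maxn i j) => //; split.
    by move: Fi; exact/subsetPset/Fnd/leq_maxl.
  by move: Gj; exact/subsetPset/Gnd/leq_maxr.
move=> i; have [mF Fi] := Foo i; have [mG Gi] := Goo i; split.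
  rewrite -[X in measurable X]setTI.
  by apply: measurable_tuncons => //; exact: measurableX.
rewrite /tcons_measure /pushforward -comp_preimage.
rewrite (_ : @tuncons n \o @tcons n = id) ?preimage_id; last first.
  by apply/funext => p /=; rewrite tconsK.
by rewrite product_measure1E// lte_mul_pinfty// ge0_fin_numE.
Qed.

HB.instance Definition _ := Measure_isSigmaFinite.Build _ _ _ tcons_measure
  tcons_measure_sigma_finite.

End TconsMeasure.

Fixpoint lebesgue_tuple (n : nat) :
    {sigma_finite_measure set (n.-tuple mR) -> \bar R} :=
  match n with
  | 0 => \d_ ([tuple] : 0.-tuple mR)
  | m.+1 => tcons_measure (lebesgue_tuple m)
  end.

End LebesgueTuple.

Section Setting.
Variable R : realType.
Local Notation C := R[i].
Local Notation mR := (measurableTypeR R).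

Definition Cintegral d (T : measurableType d) (mu : {measure set T -> \bar R})
    (f : T -> C) : C :=
  (\int[mu]_x complex.Re (f x))%R +i* (\int[mu]_x complex.Im (f x))%R.

(* Vectors of L^2(R; C^2) are handled through representatives, and operators
   through their action on representatives.                                 *)
Definition wavefun := R -> 'cV[C]_2.
Definition oper := wavefun -> wavefun.

Definition L2 (psi : wavefun) : Prop := forall i : 'I_2,
  (fun x : mR => complex.Re (psi x i 0)) \in Lfun lebesgue_measure 2%:E /\
  (fun x : mR => complex.Im (psi x i 0)) \in Lfun lebesgue_measure 2%:E.

(* conjugate-linear in the first argument *)
Definition inner (chi psi : wavefun) : C :=
  Cintegral lebesgue_measure
    (fun x : mR => \sum_(i < 2) (chi x i 0)^* * psi x i 0).

Definition is_adjoint (A B : oper) : Prop :=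
  (forall chi, L2 chi -> L2 (B chi)) /\
  (forall chi psi, L2 chi -> L2 psi -> inner chi (A psi) = inner (B chi) psi).

(* On L^2 vectors, unique up to almost everywhere equality. *)
Definition adjoint (A : oper) : oper := xget (@id wavefun) [set B : oper | is_adjoint A B].

Definition Mult (m : R -> 'M[C]_2) : oper := fun psi x => m x *m psi x.

Definition Qmx : 'M[C]_2 := delta_mx ord_max ord_max.

Section Scattering.
Variable S : 'M[C]_2.

(* U 0 is the identity *)
Definition U (t : R) : oper := fun psi x =>
  if 0 < t then
    psi (x - t) + (0 < x < t)%R%:R *: ((S - 1%:M) *m psi (x - t))
  else if t < 0 then
    psi (x - t) + (t < x < 0)%R%:R *: ((S ^t* - 1%:M) *m psi (x - t))
  else psi x.

Definition Qt (t : R) : oper := adjoint (U t) \o Mult (fun=> Qmx) \o U t.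

Definition SQ : 'M[C]_2 := S ^t* *m Qmx *m S.
Definition QS : 'M[C]_2 := S *m Qmx *m S ^t*.

(* int phi(t) I_+(t) dt and int phi(t) I_-(t) dt: the factor delta(x + t)
   evaluates the test function at -x. The null set x = 0 plays no role.     *)
Definition Iplus (phi : R -> C) : oper :=
  Mult (fun x => phi (- x) *: ((x < 0)%R%:R *: SQ + (0 < x)%R%:R *: Qmx)).
Definition Iminus (phi : R -> C) : oper :=
  Mult (fun x => - (phi (- x) *: ((x < 0)%R%:R *: Qmx + (0 < x)%R%:R *: QS))).

Definition time_ordered (A : R -> oper) (ts : seq R) : oper :=
  foldr (fun t B => A t \o B) id (sort (fun s t => t <= s) ts).

(* An operator-valued distribution D in (t_1, ..., t_k) is given by its matrix
   elements D Phi chi psi = <chi, D(Phi) psi>.                              *)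
Definition opdistr (k : nat) :=
  (k.-tuple mR -> C) -> wavefun -> wavefun -> C.

Definition Cderive (f : R -> C) (x : R) : C :=
  derive1 (fun y => complex.Re (f y) : R) x
  +i* derive1 (fun y => complex.Im (f y) : R) x.

Definition pderiv (k : nat) (i : 'I_k) (Phi : k.-tuple mR -> C)
    (t : k.-tuple mR) : C :=
  Cderive (fun s : R => Phi [tuple (if j == i then s else tnth t j) | j < k])
          (tnth t i).

Definition distr_pderiv (k : nat) (D : opdistr k) (i : 'I_k) : opdistr k :=
  fun Phi chi psi => - D (pderiv i Phi) chi psi.

Definition T_Q (k : nat) : opdistr k := fun Phi chi psi =>
  Cintegral (lebesgue_tuple R k)
    (fun t => Phi t * inner chi (time_ordered Qt t psi)).

(* foldl over enum 'I_k takes the derivative in t_1 first, in t_k last *)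
Definition Tstar (k : nat) : opdistr k :=
  foldl (@distr_pderiv k) (@T_Q k) (enum 'I_k).

(* The I_- factors stand to the right of the I_+ factors; the sum over the
   choices of sign s is the expansion of the product of the I = I_+ + I_-.  *)
Definition Ttilde (k : nat) (phi : 'I_k -> R -> C) : oper := fun psi x =>
  \sum_(s : {ffun 'I_k -> bool})
    ((\big[@comp _ _ _/id]_(i < k | s i) Iplus (phi i)) \o
     (\big[@comp _ _ _/id]_(i < k | ~~ s i) Iminus (phi i))) psi x.

End Scattering.

Definition test_function (phi : R -> C) : Prop :=
  [/\ forall n x, derivable (derive1n n (fun y => complex.Re (phi y) : R)) x 1,
      forall n x, derivable (derive1n n (fun y => complex.Im (phi y) : R)) x 1 &
      compact (closure [set x | phi x != 0])].

(* Products of the I_+ and I_- are defined on test functions of this form,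
   whose span is dense in C_c^oo(R^k).                                      *)
Definition tensor (k : nat) (phi : 'I_k -> R -> C) (t : k.-tuple mR) : C :=
  \prod_(i < k) phi i (tnth t i).

End Setting.

(* Main.v *)
(* At each position x, Q(t) is multiplication by a matrix taking only two values:
   an incoming one, A(x), for t < - x and an outgoing one, B(x), for t > - x.
   Time ordering therefore puts all B's to the left of all A's, so that
   T(Q(t_1) ... Q(t_k)) is multiplication by the sum, over all maps s from I_k
   to bool, of the indicator of (t_i > - x iff s_i, for all i) times
   B(x)^#s A(x)^(k - #s).  Integrating against derivatives of test functions,
   Fubini and the fundamental theorem of calculus turn the indicator t_i > - x
   into - phi_i(- x) and the indicator t_i < - x into phi_i(- x).  With the sign
   (-1)^k this gives a factor phi_i(- x) B(x) for each I_+ and a factor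
   - phi_i(- x) A(x) for each I_-, in the order required by T~.  The formula for
   Q(t) itself rests on the adjoint of U(t), which is unique up to null sets and
   computed by translation invariance of the Lebesgue measure. *)

Require Import Defs.
From HB Require Import structures.
From mathcomp Require Import all_boot all_order all_algebra.
From mathcomp Require Import all_classical all_reals all_analysis.
From mathcomp Require Import measurable_realfun.
From mathcomp Require Import complex ring.

Set Implicit Arguments.
Unset Strict Implicit.
Unset Printing Implicit Defensive.

Import Order.TTheory GRing.Theory Num.Theory.
Import numFieldNormedType.Exports.

Local Open Scope classical_set_scope.
Local Open Scope ring_scope.
Local Open Scope complex_scope.
Local Open Scope sesquilinear_scope.

(** * Complex-valued integrals *)

Section ComplexReIm.
Variable R : realType.
Implicit Types z w : R[i].

Lemma complex_ReD z w : complex.Re (z + w) = complex.Re z + complex.Re w.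
Proof. by case: z; case: w. Qed.

Lemma complex_ImD z w : complex.Im (z + w) = complex.Im z + complex.Im w.
Proof. by case: z; case: w. Qed.

Lemma complex_ReM z w :
  complex.Re (z * w) =
  complex.Re z * complex.Re w - complex.Im z * complex.Im w.
Proof. by case: z; case: w. Qed.

Lemma complex_ImM z w :
  complex.Im (z * w) =
  complex.Re z * complex.Im w + complex.Im z * complex.Re w.
Proof. by case: z; case: w. Qed.

Lemma complex_Re_sum I (r : seq I) (P : pred I) (F : I -> R[i]) :
  complex.Re (\sum_(i <- r | P i) F i) = \sum_(i <- r | P i) complex.Re (F i).
Proof. by apply: (big_morph _ complex_ReD). Qed.

Lemma complex_Re_conj z : complex.Re (z^*)%R = complex.Re z.
Proof. by case: z. Qed.

Lemma complex_Im_conj z : complex.Im (z^*)%R = - complex.Im z.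
Proof. by case: z. Qed.

End ComplexReIm.

Section ComplexIntegral.
Context {R : realType} d (T : measurableType d).
Variable mu : {measure set T -> \bar R}.
Local Notation C := R[i].
Implicit Types f g : T -> C.

Definition Cmeasurable f : Prop :=
  measurable_fun setT (fun x => complex.Re (f x)) /\
  measurable_fun setT (fun x => complex.Im (f x)).

Definition Cintegrable f : Prop :=
  mu.-integrable setT (EFin \o (fun x => complex.Re (f x))) /\
  mu.-integrable setT (EFin \o (fun x => complex.Im (f x))).

Lemma Cintegrable_measurable f : Cintegrable f -> Cmeasurable f.
Proof.
by case=> rf jf; split; apply/measurable_EFinP; exact: (measurable_int mu).
Qed.

Lemma eq_Cintegral f g : f =1 g -> Cintegral mu f = Cintegral mu g.
Proof. by move=> /funext ->. Qed.

Lemma ae_eq_Cintegral f g : Cmeasurable f -> Cmeasurable g ->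
  {ae mu, forall x, f x = g x} -> Cintegral mu f = Cintegral mu g.
Proof.
move=> [rf jf] [rg ig] fg; rewrite /Cintegral /Rintegral.
by congr (fine _ +i* fine _); apply: ae_eq_integral => //;
  try exact/measurable_EFinP; apply: filterS fg => x /= ->.
Qed.

Lemma CmeasurableM f g : Cmeasurable f -> Cmeasurable g ->
  Cmeasurable (fun x => f x * g x).
Proof.
move=> [rf jf] [rg ig]; split.
  under eq_fun do rewrite complex_ReM.
  by apply: measurable_funB; exact: measurable_funM.
under eq_fun do rewrite complex_ImM.
by apply: measurable_funD; exact: measurable_funM.
Qed.

Lemma CmeasurableD f g : Cmeasurable f -> Cmeasurable g ->
  Cmeasurable (fun x => f x + g x).
Proof.
move=> [rf jf] [rg ig]; split.
  by under eq_fun do rewrite complex_ReD; exact: measurable_funD.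
by under eq_fun do rewrite complex_ImD; exact: measurable_funD.
Qed.

Lemma CintegrableD f g : Cintegrable f -> Cintegrable g ->
  Cintegrable (fun x => f x + g x).
Proof.
move=> [rf jf] [rg ig]; split.
  rewrite (_ : _ \o _ = (EFin \o (fun x => complex.Re (f x))) \+
     (EFin \o (fun x => complex.Re (g x)))).
    exact: integrableD.
  by apply/funext => x /=; rewrite complex_ReD EFinD.
rewrite (_ : _ \o _ = (EFin \o (fun x => complex.Im (f x))) \+
   (EFin \o (fun x => complex.Im (g x)))).
  exact: integrableD.
by apply/funext => x /=; rewrite complex_ImD EFinD.
Qed.

Lemma CintegralD f g : Cintegrable f -> Cintegrable g ->
  Cintegral mu (fun x => f x + g x) = Cintegral mu f + Cintegral mu g.
Proof.
move=> [rf jf] [rg ig]; rewrite /Cintegral.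
rewrite -[RHS]/(_ +i* _); congr (_ +i* _); rewrite -RintegralD //.
  by apply: eq_Rintegral => x _; rewrite complex_ReD.
by apply: eq_Rintegral => x _; rewrite complex_ImD.
Qed.

Lemma Cintegrable0 : Cintegrable (fun=> 0).
Proof. by split; exact: integrable0. Qed.

Lemma Cintegral0 : Cintegral mu (fun=> 0) = 0.
Proof. by rewrite /Cintegral /Rintegral /= integral0. Qed.

Lemma Cintegrable_sum I (r : seq I) (F : I -> T -> C) :
  (forall i, Cintegrable (F i)) ->
  Cintegrable (fun x => \sum_(i <- r) F i x).
Proof.
move=> iF; elim: r => [|i r ih].
  by under eq_fun do rewrite big_nil; exact: Cintegrable0.
by under eq_fun do rewrite big_cons; exact: CintegrableD.
Qed.

Lemma Cintegral_sum I (r : seq I) (F : I -> T -> C) :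
  (forall i, Cintegrable (F i)) ->
  Cintegral mu (fun x => \sum_(i <- r) F i x) =
  \sum_(i <- r) Cintegral mu (F i).
Proof.
move=> iF; elim: r => [|i r ih].
  by under eq_fun do rewrite big_nil; rewrite big_nil Cintegral0.
under eq_fun do rewrite big_cons; rewrite big_cons -ih CintegralD //.
exact: Cintegrable_sum.
Qed.

Lemma integrable_lincomb (a b : R) (u v : T -> R) :
  mu.-integrable setT (EFin \o u) -> mu.-integrable setT (EFin \o v) ->
  mu.-integrable setT (EFin \o (fun x => a * u x + b * v x)).
Proof.
move=> iu iv; rewrite (_ : _ \o _ =
  (fun x => a%:E * (EFin \o u) x)%E \+ (fun x => b%:E * (EFin \o v) x)%E).
  by apply: integrableD => //; exact: integrableZl.
by apply/funext => x /=; rewrite EFinD !EFinM.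
Qed.

Lemma Rintegral_lincomb (a b : R) (u v : T -> R) :
  mu.-integrable setT (EFin \o u) -> mu.-integrable setT (EFin \o v) ->
  \int[mu]_x (a * u x + b * v x) =
  a * (\int[mu]_x u x) + b * (\int[mu]_x v x).
Proof.
move=> iu iv; have Z (c : R) w : mu.-integrable setT (EFin \o w) ->
    mu.-integrable setT (EFin \o (fun x => c * w x)).
  by move=> iw; rewrite (_ : _ \o _ = (fun x => c%:E * (EFin \o w) x)%E);
    [exact: integrableZl|apply/funext => x /=; rewrite EFinM].
by rewrite RintegralD ?RintegralZl //; exact: Z.
Qed.

Lemma CintegrableZ (c : C) f : Cintegrable f -> Cintegrable (fun x => c * f x).
Proof.
move=> [rf jf]; split.
  under [X in EFin \o X]eq_fun do rewrite complex_ReM -mulNr.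
  exact: integrable_lincomb.
under [X in EFin \o X]eq_fun do rewrite complex_ImM.
exact: integrable_lincomb.
Qed.

Lemma CintegralZ (c : C) f : Cintegrable f ->
  Cintegral mu (fun x => c * f x) = c * Cintegral mu f.
Proof.
move=> [rf jf]; case: c => a b; rewrite /Cintegral -[RHS]/(_ +i* _).
congr (_ +i* _).
  rewrite -mulNr -Rintegral_lincomb//.
  by apply: eq_Rintegral => x _; rewrite complex_ReM mulNr.
rewrite -Rintegral_lincomb//.
by apply: eq_Rintegral => x _; rewrite complex_ImM.
Qed.

Lemma Cintegrable_if (b : T -> bool) f : measurable_fun setT b ->
  Cintegrable f -> Cintegrable (fun x => if b x then f x else 0).
Proof.
move=> mb /[dup] /Cintegrable_measurable[mr mi] [rf jf]; split.
  apply: le_integrable rf => //.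
    apply/measurable_EFinP.
    under eq_fun do rewrite (fun_if (@complex.Re R)).
    exact: measurable_fun_ifT.
  by move=> x _ /=; case: (b x) => //=; rewrite normr0 lee_fin.
apply: le_integrable jf => //.
  apply/measurable_EFinP.
  under eq_fun do rewrite (fun_if (@complex.Im R)).
  exact: measurable_fun_ifT.
by move=> x _ /=; case: (b x) => //=; rewrite normr0 lee_fin.
Qed.

End ComplexIntegral.

(** * Change of variables for complex integrals *)

Section Pushforward.
Context {R : realType} d d' (T : measurableType d) (T' : measurableType d').
Variables (mu : {measure set T -> \bar R}) (nu : {measure set T' -> \bar R}).
Variable h : T -> T'.
Hypothesis mh : measurable_fun setT h.
(** Only agreement with the image measure on measurable sets is asked for, which serves both the
    measure on tuples and the translated Lebesgue measure. *)
Hypothesis nuE : forall A, measurable A -> nu A = mu (h @^-1` A).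

Let pf : {measure set T' -> \bar R} :=
  @measure_function_pushforward__canonical__measure_function_Measure
    _ _ _ _ _ mu _ mh.

Let integral_pf (g : T' -> \bar R) :
  (\int[nu]_x g x = \int[pf]_x g x)%E.
Proof. by apply: eq_measure_integral => A mA _; rewrite nuE. Qed.

Variable f : T' -> R[i].
Hypothesis mf : Cmeasurable f.
Hypothesis fh : Cintegrable mu (f \o h).

Lemma Cintegrable_pushforward : Cintegrable nu f.
Proof.
have I (g : T' -> R) : measurable_fun setT g ->
    mu.-integrable setT (EFin \o (g \o h)) -> nu.-integrable setT (EFin \o g).
  move=> mg ig; apply/integrableP; split; first exact/measurable_EFinP.
  rewrite integral_pf.
  have /integrableP[] // : pf.-integrable setT (EFin \o g).
  by apply: integrable_pushforward => //; exact/measurable_EFinP.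
by case: mf fh => rf jf [irf iif]; split; exact: I.
Qed.

Lemma Cintegral_pushforward : Cintegral nu f = Cintegral mu (f \o h).
Proof.
case: mf fh => rf jf [irf iif]; rewrite /Cintegral /Rintegral !integral_pf.
by congr (fine _ +i* fine _);
  (rewrite integral_pushforward //; exact/measurable_EFinP).
Qed.

End Pushforward.

(** * Fubini's theorem and products of functions of separate variables *)

Section Fubini.
Context {R : realType} d1 d2 (T1 : measurableType d1) (T2 : measurableType d2).
Variables (m1 : {sigma_finite_measure set T1 -> \bar R})
          (m2 : {sigma_finite_measure set T2 -> \bar R}).

(** The inner extended integral is finite only for almost every [x], so the [fine] inside the outer
    integral alters its integrand on a null set. *)
Lemma Rintegral12_prod_meas (f : T1 * T2 -> R) :
  (m1 \x m2)%E.-integrable setT (EFin \o f) ->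
  \int[m1]_x (\int[m2]_y f (x, y)) = \int[(m1 \x m2)%E]_z f z.
Proof.
move=> fi; congr fine; rewrite -[RHS](integral12_prod_meas1 fi).
have mF := measurable_fubini_F fi.
apply: ae_eq_integral => //.
  by apply/measurable_EFinP; exact: measurableT_comp mF.
apply: filterS (ae_integrable1 fi) => x /= xi _.
by rewrite fineK//; exact: integrable_fin_num.
Qed.

Lemma Rintegral21_prod_meas (f : T1 * T2 -> R) :
  (m1 \x m2)%E.-integrable setT (EFin \o f) ->
  \int[m2]_y (\int[m1]_x f (x, y)) = \int[(m1 \x m2)%E]_z f z.
Proof.
move=> fi; congr fine; rewrite -[RHS](integral21_prod_meas1 fi).
have mG := measurable_fubini_G fi.
apply: ae_eq_integral => //.
  by apply/measurable_EFinP; exact: measurableT_comp mG.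
apply: filterS (ae_integrable2 fi) => y /= yi _.
by rewrite fineK//; exact: integrable_fin_num.
Qed.

Lemma Cintegral12_prod_meas (f : T1 * T2 -> R[i]) :
  Cintegrable (m1 \x m2)%E f ->
  Cintegral m1 (fun x => Cintegral m2 (fun y => f (x, y))) =
  Cintegral (m1 \x m2)%E f.
Proof.
move=> [rf jf]; rewrite /Cintegral -(Rintegral12_prod_meas rf).
by rewrite -(Rintegral12_prod_meas jf).
Qed.

Lemma Cintegral21_prod_meas (f : T1 * T2 -> R[i]) :
  Cintegrable (m1 \x m2)%E f ->
  Cintegral m2 (fun y => Cintegral m1 (fun x => f (x, y))) =
  Cintegral (m1 \x m2)%E f.
Proof.
move=> [rf jf]; rewrite /Cintegral -(Rintegral21_prod_meas rf).
by rewrite -(Rintegral21_prod_meas jf).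
Qed.

(** Tonelli: the iterated integral of the absolute value factors into two finite integrals. *)
Lemma integrable_prodM (f : T1 -> R) (g : T2 -> R) :
  m1.-integrable setT (EFin \o f) -> m2.-integrable setT (EFin \o g) ->
  (m1 \x m2)%E.-integrable setT (EFin \o (fun z => f z.1 * g z.2)).
Proof.
move=> fi gi.
have mf : measurable_fun setT f by apply/measurable_EFinP/(measurable_int m1).
have mg : measurable_fun setT g by apply/measurable_EFinP/(measurable_int m2).
apply/integrable12ltyP.
  apply/measurable_EFinP; apply: measurable_funM.
    exact: measurableT_comp mf measurable_fst.
  exact: measurableT_comp mg measurable_snd.
have /integrableP[_ foo] := fi; have /integrableP[_ goo] := gi.
have mgn : measurable_fun setT (fun y => `|(g y)%:E|%E).
  by apply: measurableT_comp => //; exact/measurable_EFinP.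
have mfn : measurable_fun setT (fun x => `|(f x)%:E|%E).
  by apply: measurableT_comp => //; exact/measurable_EFinP.
pose G := (\int[m2]_y `|(g y)%:E|)%E.
have G0 : (0 <= G)%E by exact: integral_ge0.
have GE x : (\int[m2]_y `|(f x * g y)%:E| = G * `|(f x)%:E|)%E.
  transitivity (\int[m2]_y (`|(f x)%:E| * `|(g y)%:E|))%E.
    by apply: eq_integral => y _; rewrite EFinM abseM.
  by rewrite (ge0_integralZl _ measurableT mgn) //; exact: muleC.
rewrite (eq_integral (fun x => G * `|(f x)%:E|)%E); last first.
  by move=> x _; exact: GE.
rewrite (ge0_integralZl _ measurableT mfn) //.
by rewrite lte_mul_pinfty // ge0_fin_numE.
Qed.

Lemma Cintegrable_prodM (f : T1 -> R[i]) (g : T2 -> R[i]) :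
  Cintegrable m1 f -> Cintegrable m2 g ->
  Cintegrable (m1 \x m2)%E (fun z => f z.1 * g z.2).
Proof.
move=> [rf jf] [rg ig]; split.
  rewrite (_ : _ \o _ = (EFin \o (fun z : T1 * T2 => (complex.Re (f z.1) *
    complex.Re (g z.2))%R))
    \- (EFin \o (fun z : T1 * T2 => (complex.Im (f z.1) * complex.Im (g
      z.2))%R)))%E; last first.
    by apply/funext => z; exact: (congr1 EFin (complex_ReM _ _)).
  apply: integrableB => //; [exact: (@integrable_prodM (fun x => complex.Re (f
    x)) (fun x => complex.Re (g x)))|exact: (@integrable_prodM (fun x =>
    complex.Im (f x)) (fun x => complex.Im (g x)))].
rewrite (_ : _ \o _ = (EFin \o (fun z : T1 * T2 => (complex.Re (f z.1) *
  complex.Im (g z.2))%R))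
  \+ (EFin \o (fun z : T1 * T2 => (complex.Im (f z.1) * complex.Re (g
    z.2))%R)))%E; last first.
  by apply/funext => z; exact: (congr1 EFin (complex_ImM _ _)).
apply: integrableD => //; [exact: (@integrable_prodM (fun x => complex.Re (f
  x)) (fun x => complex.Im (g x)))|exact: (@integrable_prodM (fun x =>
  complex.Im (f x)) (fun x => complex.Re (g x)))].
Qed.

Lemma Cintegral_prodM (f : T1 -> R[i]) (g : T2 -> R[i]) :
  Cintegrable m1 f -> Cintegrable m2 g ->
  Cintegral (m1 \x m2)%E (fun z => f z.1 * g z.2) =
  Cintegral m1 f * Cintegral m2 g.
Proof.
move=> fi gi; rewrite -Cintegral12_prod_meas; last exact: Cintegrable_prodM.
rewrite (@eq_Cintegral _ _ _ _ _ (fun x => Cintegral m2 g * f x)).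
  by rewrite CintegralZ // mulrC.
by move=> x; rewrite -[LHS]/(Cintegral m2 (fun y => f x * g y)) CintegralZ //
  mulrC.
Qed.

End Fubini.

(** * Integrals of tensor products over R^k *)

Section TupleIntegral.
Variable R : realType.
Local Notation mR := (measurableTypeR R).

Lemma Cmeasurable_comp d (T : measurableType d) d' (T' : measurableType d')
    (f : T' -> R[i]) (h : T -> T') :
  Cmeasurable f -> measurable_fun setT h -> Cmeasurable (f \o h).
Proof.
by move=> [rf jf] mh; split; [exact: measurableT_comp rf mh|
  exact: measurableT_comp jf mh].
Qed.

Lemma tensor_tcons n (f : 'I_n.+1 -> R -> R[i]) :
  tensor f \o @tcons R n =
  (fun z => f ord0 z.1 * tensor (fun i => f (lift ord0 i)) z.2).
Proof.
apply/funext => -[x t] /=; rewrite /tensor big_ord_recl; congr (f ord0 _ * _).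
by apply: eq_bigr => i _; congr (f _ _); rewrite !(tnth_nth 0).
Qed.

(** Induction on [n], splitting off the first coordinate. Integrability and value are proved
    together because the product formula for the value requires integrability of the remaining
    factors. *)
Lemma Cintegrable_tensor n (f : 'I_n -> R -> R[i]) :
  (forall i, Cintegrable (@lebesgue_measure R) (f i)) ->
  Cintegrable (lebesgue_tuple R n) (tensor f) /\
  Cintegral (lebesgue_tuple R n) (tensor f) =
    \prod_(i < n) Cintegral (@lebesgue_measure R) (f i).
Proof.
elim: n f => [f _|n ih f fi].
  have -> : tensor f = fun=> 1 by apply/funext => t; rewrite /tensor big_ord0.
  have intc (r : R) : (\int[lebesgue_tuple R 0]_t r%:E)%E = r%:E.
    have := @integral_dirac _ (0.-tuple mR) [tuple] R setT measurableT
      (cst r%:E) (measurable_cst _).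
    by rewrite diracT mul1e.
  split; last by rewrite big_ord0 /Cintegral /Rintegral !intc.
  split; last exact: integrable0.
  apply: (@measurable_bounded_integrable _ _ _ (lebesgue_tuple R 0) (cst 1)) =>
    //.
  - by rewrite /= diracT ltry.
  - exact: bounded_cst.
have [ti tE] := ih (fun i => f (lift ord0 i)) (fun i => fi _).
have ci : Cintegrable (@lebesgue_measure R \x lebesgue_tuple R n)%E (tensor f
  \o @tcons R n).
  by rewrite tensor_tcons; exact: Cintegrable_prodM.
have mf : Cmeasurable (tensor f).
  (* Measurability on tuples is pulled back from the product space through the measurable inverse of
     [tcons]. *)
  have -> : tensor f = (tensor f \o @tcons R n) \o @tuncons R n.
    apply/funext => t /=; congr tensor.
    by case/tupleP: t => x t; apply: val_inj.
  exact: (Cmeasurable_comp (Cintegrable_measurable ci) (@measurable_tuncons R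
    n)).
split.
  apply: (Cintegrable_pushforward (@measurable_tcons R n)) mf ci => //.
rewrite (Cintegral_pushforward (@measurable_tcons R n) _ mf ci) //.
by rewrite tensor_tcons Cintegral_prodM // tE big_ord_recl.
Qed.

End TupleIntegral.

(** * Square-integrable functions and adjoints *)

Section SquareIntegrable.
Context {R : realType} d (T : measurableType d).
Variable mu : {measure set T -> \bar R}.
Implicit Types f g : T -> R.

(** Reduces membership in L^2 to integrability of the square, where domination arguments apply. *)
Lemma Lfun2P f : f \in Lfun mu 2%:E <->
  measurable_fun setT f /\ mu.-integrable setT (EFin \o (fun x => f x ^+ 2)).
Proof.
split=> [f2|[mf /integrableP[_ foo]]].
  split; last exact: Lfun2_integrable_sqr.
  by move: f2; rewrite inE => /andP[/[!inE]].
rewrite inE; apply/andP; split; rewrite inE //=.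
rewrite /finite_norm unlock poweR_lty //.
apply: le_lt_trans foo; apply: ge0_le_integral => //.
- by move=> x _; rewrite poweR_ge0.
- have -> : (fun x => `|(f x)%:E| `^ 2)%E = EFin \o (fun x => `|f x| `^ 2).
    by apply/funext => x.
  apply/measurable_EFinP.
  apply/(@measurableT_comp _ _ _ _ _ _ (fun x : R => x `^ 2)%R) => //.
  exact: measurableT_comp.
- by apply: measurableT_comp => //; apply/measurable_EFinP;
  exact: measurable_funX.
- by move=> x _ /=; rewrite lee_fin powR_mulrn // normrX.
Qed.

(** The square of [a f + b g] is at most [2 a^2 f^2 + 2 b^2 g^2], the difference being the square of
    [a f - b g]. *)
Lemma Lfun2_lincomb (a b : R) f g : f \in Lfun mu 2%:E -> g \in Lfun mu 2%:E ->
  (fun x => a * f x + b * g x) \in Lfun mu 2%:E.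
Proof.
move=> /Lfun2P[mf f2] /Lfun2P[mg g2]; apply/Lfun2P.
have mc : measurable_fun setT (fun x => a * f x + b * g x).
  by apply: measurable_funD; apply: measurable_funM.
split=> //; apply: le_integrable (integrable_lincomb (2 * a ^+ 2) (2 * b ^+ 2)
  f2 g2) => //.
  by apply/measurable_EFinP; exact: measurable_funX.
move=> x _ /=; rewrite lee_fin ger0_norm ?sqr_ge0 //.
apply: le_trans (ler_norm _); rewrite -subr_ge0.
rewrite (_ : _ - _ = (a * f x - b * g x) ^+ 2) ?sqr_ge0 //.
by ring.
Qed.

Lemma Lfun2_if (b : T -> bool) f g : measurable_fun setT b ->
  f \in Lfun mu 2%:E -> g \in Lfun mu 2%:E ->
  (fun x => if b x then f x else g x) \in Lfun mu 2%:E.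
Proof.
move=> mb /Lfun2P[mf f2] /Lfun2P[mg g2]; apply/Lfun2P.
have mc : measurable_fun setT (fun x => if b x then f x else g x).
  exact: measurable_fun_ifT.
split=> //; apply: le_integrable (integrable_lincomb 1 1 f2 g2) => //.
  by apply/measurable_EFinP; exact: measurable_funX.
move=> x _ /=; rewrite lee_fin ger0_norm ?sqr_ge0 // !mul1r.
rewrite ger0_norm ?addr_ge0 ?sqr_ge0 //.
by case: (b x); rewrite ?lerDl ?lerDr sqr_ge0.
Qed.

End SquareIntegrable.

(** * Translation invariance of the Lebesgue measure *)

Section Translation.
Variable R : realType.
Local Notation mR := (measurableTypeR R).
Local Notation leb := (@lebesgue_measure R).

Lemma measurable_shift (t : R) :
  measurable_fun (@setT mR) (fun x : mR => x + t : mR).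
Proof. exact: (measurable_funD (f := fun x : mR => x : R)). Qed.

(** The image measure gives half-open intervals their length, and this characterizes the Lebesgue
    measure. *)
Lemma lebesgue_measure_shift (t : R) (A : set mR) : measurable A ->
  leb A = leb ((fun x : mR => x + t : mR) @^-1` A).
Proof.
pose pf : {measure set mR -> \bar R} :=
  @measure_function_pushforward__canonical__measure_function_Measure
    _ _ _ _ _ leb _ (measurable_shift t).
apply: (@lebesgue_measure_unique R pf) => _ [[a b] _ <-] /=.
rewrite /pf /= /pushforward.
have -> : (fun x : mR => x + t : mR) @^-1` `]a, b]%classic =
  `](a - t), (b - t)]%classic.
  by apply/seteqP; split => x /=; rewrite !in_itv /= ltrBlDr lerBrDr.
by rewrite !lebesgue_measure_itv /= !lte_fin ltrD2r -!EFinD opprB addrA subrK.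
Qed.

Lemma Cintegral_shift (t : R) (f : mR -> R[i]) :
  Cintegrable leb (fun x => f (x + t)) ->
  Cintegral leb (fun x => f (x + t)) = Cintegral leb f.
Proof.
move=> fi; have mf : Cmeasurable f.
  have -> : f = (fun x => f (x + t)) \o (fun x : mR => x - t : mR).
    by apply/funext => x /=; rewrite subrK.
  by apply: Cmeasurable_comp (measurable_shift _);
    exact: Cintegrable_measurable fi.
by rewrite (Cintegral_pushforward (measurable_shift t) (@lebesgue_measure_shift
  t) mf fi).
Qed.

Lemma Lfun2_shift (t : R) (f : mR -> R) : f \in Lfun leb 2%:E ->
  (fun x => f (x + t)) \in Lfun leb 2%:E.
Proof.
move=> /Lfun2P[mf f2]; apply/Lfun2P; split.
  exact: measurableT_comp mf (measurable_shift t).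
(* The square is made complex-valued so that the change of variables above applies; composing with
   the shift by [- t] gives back [f ^+ 2]. *)
pose g := fun x : mR => (f (x + t) ^+ 2)%:C.
have : Cintegrable leb g; last by case.
apply: (Cintegrable_pushforward (measurable_shift (- t))
  (@lebesgue_measure_shift _)).
  split => //=; apply: measurable_funX.
  exact: measurableT_comp mf (measurable_shift t).
split => /=; last exact: integrable0.
by apply: eq_integrable f2 => // x _ /=; rewrite subrK.
Qed.

End Translation.

(** * Square-integrable vectors and uniqueness of adjoints *)

Section L2Theory.
Variable R : realType.
Local Notation mR := (measurableTypeR R).
Local Notation leb := (@lebesgue_measure R).
Implicit Types (chi psi : wavefun R).

Lemma lebesgue_aeS (P Q : mR -> Prop) : (forall x, P x -> Q x) ->
  {ae leb, forall x, P x} -> {ae leb, forall x, Q x}.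
Proof. exact: (@filterS _ _ (ae_filter_ringOfSetsType leb)). Qed.

Lemma lebesgue_aeS2 (P P' Q : mR -> Prop) : (forall x, P x -> P' x -> Q x) ->
  {ae leb, forall x, P x} -> {ae leb, forall x, P' x} ->
  {ae leb, forall x, Q x}.
Proof. exact: (@filterS2 _ _ (ae_filter_ringOfSetsType leb)). Qed.

Lemma L2_if (b : mR -> bool) chi psi : measurable_fun setT b ->
  L2 chi -> L2 psi -> L2 (fun x => if b x then chi x else psi x).
Proof.
move=> mb c2 p2 i; have [? ?] := c2 i; have [? ?] := p2 i; split.
  rewrite (_ : (fun x => _) = fun x => if b x then complex.Re (chi x i 0)
    else complex.Re (psi x i 0)); first exact: Lfun2_if.
  by apply/funext => x; case: (b x).
rewrite (_ : (fun x => _) = fun x => if b x then complex.Im (chi x i 0)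
  else complex.Im (psi x i 0)); first exact: Lfun2_if.
by apply/funext => x; case: (b x).
Qed.

Lemma L2_shift (t : R) psi : L2 psi -> L2 (fun x => psi (x + t)).
Proof.
move=> p2 i; have [rp ip] := p2 i.
by split; [exact: Lfun2_shift rp|exact: Lfun2_shift ip].
Qed.

Lemma L2B chi psi : L2 chi -> L2 psi -> L2 (fun x => chi x - psi x).
Proof.
move=> c2 p2 i; have [rc ic] := c2 i; have [rp ip] := p2 i; split.
  rewrite (_ : (fun x => _) = fun x => 1 * complex.Re (chi x i 0) +
    (-1) * complex.Re (psi x i 0)); first exact: Lfun2_lincomb.
  by apply/funext => x; rewrite !mxE;
    case: (chi x i 0) (psi x i 0) => ? ? [? ?] /=; rewrite mul1r mulN1r.
rewrite (_ : (fun x => _) = fun x => 1 * complex.Im (chi x i 0) +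
  (-1) * complex.Im (psi x i 0)); first exact: Lfun2_lincomb.
by apply/funext => x; rewrite !mxE;
  case: (chi x i 0) (psi x i 0) => ? ? [? ?] /=; rewrite mul1r mulN1r.
Qed.

Lemma L2_mulmx (M : 'M[R[i]]_2) psi : L2 psi -> L2 (fun x => M *m psi x).
Proof.
move=> p2 i; have [r0 i0] := p2 ord0; have [r1 i1] := p2 ord_max.
(* Real and imaginary parts of a component of [M *m psi] are real linear combinations of the four
   real functions that make up [psi]. *)
have comb (a b c d : R) : (fun x : mR =>
    1 * (a * complex.Re (psi x ord0 0) + b * complex.Im (psi x ord0 0)) +
    1 * (c * complex.Re (psi x ord_max 0) + d * complex.Im (psi x ord_max 0)))
    \in Lfun leb 2%:E.
  by apply: Lfun2_lincomb; exact: Lfun2_lincomb.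
split.
  rewrite (_ : (fun x => _) = fun x => 1 * (complex.Re (M i ord0) *
    complex.Re (psi x ord0 0) +
    - complex.Im (M i ord0) * complex.Im (psi x ord0 0)) +
    1 * (complex.Re (M i ord_max) * complex.Re (psi x ord_max 0) +
     - complex.Im (M i ord_max) * complex.Im (psi x ord_max 0)));
       first exact: comb.
  apply/funext => x; rewrite mxE !big_ord_recl big_ord0 addr0 complex_ReD
    !complex_ReM !mul1r !mulNr.
  by rewrite (_ : lift ord0 ord0 = ord_max) //; apply: val_inj.
rewrite (_ : (fun x => _) = fun x => 1 * (complex.Im (M i ord0) *
    complex.Re (psi x ord0 0) +
    complex.Re (M i ord0) * complex.Im (psi x ord0 0)) +
    1 * (complex.Im (M i ord_max) * complex.Re (psi x ord_max 0) +
     complex.Re (M i ord_max) * complex.Im (psi x ord_max 0)));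
       first exact: comb.
apply/funext => x; rewrite mxE !big_ord_recl big_ord0 addr0 complex_ImD
  !complex_ImM !mul1r.
rewrite (_ : lift ord0 ord0 = ord_max) //; last exact: val_inj.
by rewrite [X in X + _]addrC [X in _ + X]addrC.
Qed.

(** Convertible to the integrand of [inner], so that facts about [Cintegral] transfer to inner
    products. *)
Definition inner_density chi psi (x : mR) : R[i] :=
  \sum_(i < 2) (chi x i 0)^* * psi x i 0.

Lemma Cintegrable_inner chi psi : L2 chi -> L2 psi ->
  Cintegrable leb (inner_density chi psi).
Proof.
move=> c2 p2; apply: Cintegrable_sum => i.
have [rc ic] := c2 i; have [rp ip] := p2 i.
have I := fun f g (f2 : f \in Lfun leb 2%:E) (g2 : g \in Lfun leb 2%:E) =>
  (Lfun1_integrable _ _).1 (Lfun2_mul_Lfun1 f2 g2).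
split.
  rewrite (_ : _ \o _ = (EFin \o (fun x : mR => (complex.Re (chi x i 0) *
    complex.Re (psi x i 0))%R))
    \+ (EFin \o (fun x : mR => (complex.Im (chi x i 0) *
      complex.Im (psi x i 0))%R)))%E; last first.
    by apply/funext => x; apply: (congr1 EFin);
      rewrite complex_ReM complex_Re_conj complex_Im_conj mulNr opprK.
  by apply: integrableD => //; exact: I.
rewrite (_ : _ \o _ = (EFin \o (fun x : mR => (complex.Re (chi x i 0) *
  complex.Im (psi x i 0))%R))
    \- (EFin \o (fun x : mR => (complex.Im (chi x i 0) *
      complex.Re (psi x i 0))%R)))%E; last first.
  by apply/funext => x; apply: (congr1 EFin);
    rewrite complex_ImM complex_Re_conj complex_Im_conj mulNr.
by apply: integrableB => //; exact: I.
Qed.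

(** The density of [inner chi chi] has as real part a sum of squares; a nonnegative function with
    zero integral vanishes almost everywhere. *)
Lemma inner_self_eq0 chi : L2 chi -> inner chi chi = 0 ->
  {ae leb, forall x, chi x = 0}.
Proof.
move=> c2 /(congr1 (@complex.Re R)) /= c0.
have [ri _] := Cintegrable_inner c2 c2.
pose f x := complex.Re (inner_density chi chi x).
have fE x : f x = \sum_(i < 2) (complex.Re (chi x i 0) ^+ 2 +
    complex.Im (chi x i 0) ^+ 2).
  rewrite /f complex_Re_sum; apply: eq_bigr => i _.
  by rewrite complex_ReM complex_Re_conj complex_Im_conj mulNr opprK !expr2.
have f0 x : 0 <= f x by rewrite fE sumr_ge0 // => i _;
  rewrite addr_ge0 ?sqr_ge0.
have : (\int[leb]_x `|(f x)%:E| = 0)%E.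
  under eq_integral do rewrite gee0_abs ?lee_fin //.
  (* As [fine] also sends infinite values to 0, finiteness of the integral is needed to conclude
     from [c0]. *)
  by rewrite -[LHS]fineK; [rewrite [fine _]c0|exact: integrable_fin_num].
move/(ae_eq_integral_abs _ measurableT (measurable_int _ ri)).1.
apply: lebesgue_aeS => x /(_ I) [] /= fx0; apply/matrixP => i j;
  rewrite ord1 mxE.
move/eqP: fx0; rewrite -/(f x) fE psumr_eq0 => [|k _];
  last by rewrite addr_ge0 ?sqr_ge0.
move=> /allP /(_ i); rewrite mem_index_enum => /(_ isT).
rewrite /= paddr_eq0 ?sqr_ge0 // !sqrf_eq0 => /andP[/eqP + /eqP].
by case: (chi x i 0) => a b /= -> ->.
Qed.

Lemma innerBl chi chi' psi : L2 chi -> L2 chi' -> L2 psi ->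
  inner (fun x => chi x - chi' x) psi = inner chi psi - inner chi' psi.
Proof.
move=> c2 c2' p2; rewrite -mulN1r.
rewrite -[X in _ + _ * X](_ : Cintegral leb (inner_density chi' psi) = _) //.
rewrite -CintegralZ; last exact: Cintegrable_inner.
rewrite -[X in X + _](_ : Cintegral leb (inner_density chi psi) = _) //.
rewrite -CintegralD; [|exact: Cintegrable_inner|].
  apply: eq_Cintegral => x; rewrite /inner_density mulr_sumr -big_split /=.
  by apply: eq_bigr => i _; rewrite !mxE rmorphB /= mulrBl mulN1r.
by apply: CintegrableZ; exact: Cintegrable_inner.
Qed.

(** For [d = B chi - B' chi], both [inner (B chi) d] and [inner (B' chi) d] equal [inner chi (A d)],
    hence [inner d d = 0]. *)
Lemma is_adjoint_ae_unique (A B B' : oper R) chi :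
  is_adjoint A B -> is_adjoint A B' -> L2 chi ->
  {ae leb, forall x, B chi x = B' chi x}.
Proof.
move=> [B2 AB] [B2' AB'] c2.
have d2 : L2 (fun x => B chi x - B' chi x) by apply: L2B; auto.
have : {ae leb, forall x, B chi x - B' chi x = 0}.
  apply: (inner_self_eq0 d2).
  by rewrite innerBl; auto; rewrite -AB // -AB' // subrr.
by apply: lebesgue_aeS => x /eqP; rewrite subr_eq0 => /eqP.
Qed.

(** [xget] picks an element of the set as soon as one is exhibited. *)
Lemma adjointP (A B : oper R) : is_adjoint A B -> is_adjoint A (adjoint A).
Proof. by move=> AB; exact: (xgetI _ AB). Qed.

End L2Theory.

(** * Time evolution and time-ordered products *)

Section Evolution.
Variables (R : realType) (S : 'M[R[i]]_2).
Local Notation C := R[i].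
Local Notation mR := (measurableTypeR R).
Local Notation leb := (@lebesgue_measure R).
Local Notation Q := (Qmx R).
Implicit Types (chi psi : wavefun R) (t x : R).

(** The matrix by which the time evolution multiplies the translated vector. The first two cases
    force opposite signs of [t], so the order of the tests is immaterial. *)
Definition scatter t x : 'M[C]_2 :=
  if 0 < x < t then S else if t < x < 0 then S ^t* else 1%:M.

Lemma U_scatter t psi : U S t psi = fun x => scatter t x *m psi (x - t).
Proof.
apply/funext => x; rewrite /U /scatter; have [t0|t0] := ltP 0 t.
  have [_|_] := boolP (0 < x < t).
    by rewrite scale1r mulmxBl mul1mx addrC subrK.
  rewrite scale0r addr0 ifF ?mul1mx //; apply/negP => /andP [] tx x0.
  by have := lt_trans (lt_trans tx x0) t0; rewrite ltxx.
have -> : (0 < x < t) = false.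
  by apply/negP => /andP [] x0 xt; have := lt_trans x0 xt; rewrite ltNge t0.
have [t0'|t0'] := ltP t 0.
  have [_|_] := boolP (t < x < 0).
    by rewrite scale1r mulmxBl mul1mx addrC subrK.
  by rewrite scale0r addr0 mul1mx.
have -> : t = 0 by apply/eqP; rewrite eq_le t0 t0'.
by rewrite (_ : 0 < x < 0 = false) ?subr0 ?mul1mx //;
  apply/negP => /andP [] x0 /(lt_trans x0); rewrite ltxx.
Qed.

Lemma measurable_between t s : measurable_fun setT
  (fun x : mR => t < (x : R) < s).
Proof. by apply: measurable_and; apply: measurable_fun_ltr. Qed.

Lemma L2_scatter t psi : L2 psi -> L2 (fun x => scatter t x *m psi x).
Proof.
move=> p2; have -> : (fun x => scatter t x *m psi x) = fun x =>
    if 0 < x < t then S *m psi x else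
    if t < x < 0 then S ^t* *m psi x else psi x.
  by apply/funext => x; rewrite /scatter; case: ifP => // _; case: ifP => // _;
    rewrite mul1mx.
apply: (L2_if (measurable_between 0 t)); first exact: L2_mulmx.
by apply: (L2_if (measurable_between t 0)) => //; exact: L2_mulmx.
Qed.

Lemma L2_scatter_adj t psi : L2 psi -> L2 (fun x => (scatter t x) ^t* *m psi x).
Proof.
move=> p2; have -> : (fun x => (scatter t x) ^t* *m psi x) = fun x =>
    if 0 < x < t then S ^t* *m psi x
    else if t < x < 0 then S ^t* ^t* *m psi x else 1%:M ^t* *m psi x.
  by apply/funext => x; rewrite /scatter; case: ifP => // _; case: ifP.
apply: (L2_if (measurable_between 0 t)); first exact: L2_mulmx.
by apply: (L2_if (measurable_between t 0)) => //; exact: L2_mulmx.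
Qed.

Lemma L2_U t psi : L2 psi -> L2 (U S t psi).
Proof. by move=> p2; rewrite U_scatter; apply: L2_scatter; exact: L2_shift. Qed.

Lemma sum_conj_mulmx (M : 'M[C]_2) (c p : 'cV[C]_2) :
  \sum_(i < 2) (c i 0)^* * (M *m p) i 0 =
  \sum_(i < 2) ((M ^t* *m c) i 0)^* * p i 0.
Proof.
under eq_bigr do rewrite mxE mulr_sumr.
rewrite exchange_big /=; apply: eq_bigr => j _.
rewrite mxE rmorph_sum mulr_suml /=; apply: eq_bigr => i _.
by rewrite !mxE rmorphM /= conjCK mulrA [X in X * _]mulrC.
Qed.

(** Replacing [x] by [x + t] in the integral undoes the translation in [U S t]; the matrix then
    moves to the other side of the scalar product at each point. *)
Lemma is_adjoint_U t :
  is_adjoint (U S t) (fun chi y => (scatter t (y + t)) ^t* *m chi (y + t)).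
Proof.
split=> [chi c2|chi psi c2 p2].
  exact: (L2_shift t (L2_scatter_adj t c2)).
have U2 := L2_U t p2.
rewrite -[LHS]/(Cintegral leb (inner_density chi (U S t psi))).
rewrite -(Cintegral_shift (t := t)); last first.
  exact: (Cintegrable_inner (L2_shift t c2) (L2_shift t U2)).
by apply: eq_Cintegral => x; rewrite /inner_density U_scatter addrK
  sum_conj_mulmx.
Qed.

(* [later x t] means t > - x, i.e. a particle started at [x] has passed the
   scatterer at time [t].  At the boundary t = - x its value is chosen so that
   [scatter_conj] holds everywhere, not only almost everywhere. *)
Definition later x t := if x < 0 then - x < t else - x <= t.
Definition Q_in x := if x <= 0 then Q else QS S.
Definition Q_out x := if x < 0 then SQ S else Q.
Definition Q_at t x := if later x t then Q_out x else Q_in x.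

(** The left side is the matrix of [U(t)^* Q U(t)] at [x]. It is [S^* Q S] when [x < 0] and
    [- x < t], [S Q S^*] when [0 < x] and [t < - x], and [Q] otherwise. *)
Lemma scatter_conj t x :
  (scatter t (x + t)) ^t* *m Q *m scatter t (x + t) = Q_at t x.
Proof.
rewrite /scatter gtrDr ltrDr -[0 < x + t]ltrBlDr sub0r -[x + t < 0]ltrBrDr
  sub0r.
rewrite /Q_at /later /Q_out /Q_in.
have [x0|x0|->] := ltgtP x 0; rewrite ?andbF ?andbT /=.
- rewrite ltrNl; case: ifP => // _.
  by rewrite trmx1 map_mx1 mul1mx mulmx1.
- rewrite lerNl [x < _]ltNge; case: (- t <= x) => /=; last first.
    by rewrite /QS; congr (_ *m _ *m _); apply/matrixP => i j;
      rewrite !mxE conjCK.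
  by rewrite trmx1 map_mx1 mul1mx mulmx1.
- by rewrite if_same trmx1 map_mx1 mul1mx mulmx1.
Qed.

(** The chosen adjoint is compared with the explicit one at the single vector [Q U(t) psi], where
    they agree up to a null set. *)
Lemma Qt_ae t psi : L2 psi ->
  L2 (Qt S t psi) /\ {ae leb, forall x, Qt S t psi x = Q_at t x *m psi x}.
Proof.
move=> p2; have QU2 : L2 (Mult (fun=> Q) (U S t psi)) by apply/L2_mulmx/L2_U.
have ad := is_adjoint_U t; have ad' := adjointP ad; split; first exact: ad'.1.
apply: lebesgue_aeS (is_adjoint_ae_unique ad' ad QU2) => x E; apply: (etrans E).
by rewrite /Mult U_scatter addrK -scatter_conj !mulmxA.
Qed.

(** Square-integrability is carried through the induction because the formula for each further
    factor holds on L^2 vectors only; each factor adds one null set. *)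
Lemma foldr_Qt_ae (l : seq R) psi : L2 psi ->
  L2 (foldr (fun t B => Qt S t \o B) id l psi) /\
  {ae leb, forall x, foldr (fun t B => Qt S t \o B) id l psi x =
    foldr (fun t M => Q_at t x * M) 1 l *m psi x}.
Proof.
move=> p2; elim: l => [|t l [l2 lE]] /=.
  by split => //; apply: (lebesgue_aeS (P := fun=> True)) (aeW _ _) => // x _;
    rewrite mul1mx.
have [t2 tE] := Qt_ae t l2; split=> //.
by apply: lebesgue_aeS2 lE tE => x lx ->; rewrite lx mulmxA.
Qed.

Lemma laterS x s t : s <= t -> later x s -> later x t.
Proof.
by rewrite /later; case: ifP => _ st; [move/lt_le_trans|move/le_trans]; exact.
Qed.

(** [later x] is monotone in time, so in a decreasing list the times that satisfy it form an initial
    segment. *)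
Lemma prod_sorted_Q_at x (l : seq R) : sorted (fun s t => t <= s) l ->
  foldr (fun t M => Q_at t x * M) 1 l =
  (\prod_(t <- l | later x t) Q_out x) * (\prod_(t <- l | ~~ later x t) Q_in x).
Proof.
have tr : transitive (fun s t : R => t <= s) by move=> b a c ab bc;
  exact: le_trans bc ab.
elim: l => [_|t l ih] /=; first by rewrite !big_nil mulr1.
move=> tl; rewrite (ih (path_sorted tl)) !big_cons /Q_at.
have [lt|lt] := boolP (later x t); first by rewrite mulrA.
(* If the head [t] is not later, no earlier time is, and the product of [Q_out] over the tail is
   empty. *)
rewrite big_seq_cond big_pred0 ?mul1r // => s; apply/negP => /andP[sl ls].
by move: lt; rewrite (laterS _ ls) //; exact: (allP (order_path_min tr tl)).
Qed.

Lemma time_ordered_ae (k : nat) (ts : k.-tuple mR) psi : L2 psi ->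
  L2 (time_ordered (Qt S) ts psi) /\
  {ae leb, forall x, time_ordered (Qt S) ts psi x =
    (\prod_(i < k | later x (tnth ts i)) Q_out x) *m
    (\prod_(i < k | ~~ later x (tnth ts i)) Q_in x) *m psi x}.
Proof.
move=> p2; rewrite /time_ordered; set l := sort _ _.
have [l2 lE] := foldr_Qt_ae l p2; split => //.
apply: lebesgue_aeS lE => x ->; rewrite prod_sorted_Q_at; last first.
  by apply: sort_sorted => a b; exact: le_total.
rewrite -(big_tuple _ _ ts (later x) (fun=> Q_out x)).
rewrite -(big_tuple _ _ ts (fun t => ~~ later x t) (fun=> Q_in x)).
(* All factors are equal, so only the number of times satisfying [P] matters, and sorting preserves
   it. *)
have prod_sort (P : pred R) (M : 'M[C]_2) :
    \prod_(t <- l | P t) M = \prod_(t <- ts | P t) M.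
  by rewrite !big_const_seq; congr iter; apply/seq.permP; rewrite perm_sort.
by rewrite !prod_sort.
Qed.

Lemma L2_Q_out_in I (r : seq I) (P P' : pred I) psi : L2 psi ->
  L2 (fun x =>
    (\prod_(i <- r | P i) Q_out x) *m (\prod_(i <- r | P' i) Q_in x) *m psi x).
Proof.
(* The matrix products are constant on each of [x < 0], [x = 0] and [x > 0]. *)
move=> p2; have -> : (fun x => (\prod_(i <- r | P i) Q_out x) *m
    (\prod_(i <- r | P' i) Q_in x) *m psi x) = fun x =>
    if x < 0 then
      (\prod_(i <- r | P i) SQ S) *m ((\prod_(i <- r | P' i) Q) *m psi x)
    else if x <= 0 then
      (\prod_(i <- r | P i) Q) *m ((\prod_(i <- r | P' i) Q) *m psi x)
    else (\prod_(i <- r | P i) Q) *m ((\prod_(i <- r | P' i) QS S) *m psi x).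
  by apply/funext => x; rewrite -mulmxA /Q_out /Q_in; case: ltgtP.
apply: L2_if; first exact: measurable_fun_ltr.
  by do 2 apply: L2_mulmx.
apply: L2_if; first exact: measurable_fun_ler.
  by do 2 apply: L2_mulmx.
by do 2 apply: L2_mulmx.
Qed.

End Evolution.

(** * Test functions and distributional derivatives *)

Section CompactSupport.
Variable R : realType.
Local Notation mR := (measurableTypeR R).
Local Notation leb := (@lebesgue_measure R).
Variables (f : R -> R) (M : R).
Hypothesis df : forall n x, derivable (derive1n n f) x 1.
Hypothesis f0 : forall x, M <= `|x| -> f x = 0.
Local Notation f' := (derive1 f).

Let cf : continuous f.
Proof.
by move=> x; have /derivable1_diffP/differentiable_continuous := @df 0%N x.
Qed.

Let cf' : continuous f'.
Proof.
by move=> x; have /derivable1_diffP/differentiable_continuous := @df 1%N x.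
Qed.

(** The inequality is strict so that [f] vanishes on a neighbourhood of [x]. *)
Let f'0 x : M < `|x| -> f' x = 0.
Proof.
move=> Mx; rewrite derive1E -(derive_cst (0 : R) x 1).
apply: near_eq_derive; have : \forall y \near x, M < `|y|.
  exact: (cvgr_norm_gt (f := id) x cvg_id).
by apply: filterS => y /ltW/f0.
Qed.

Lemma measurable_deriv : measurable_fun (@setT mR) f'.
Proof. exact: continuous_measurable_fun. Qed.

(** The derivative is continuous on a compact interval and zero outside it. *)
Lemma integrable_deriv : leb.-integrable setT (EFin \o f').
Proof.
pose A : set R := `[- (`|M| + 1), `|M| + 1]%classic.
have Ai : leb.-integrable A (EFin \o f').
  apply: continuous_compact_integrable; first exact: segment_compact.
  exact: continuous_subspaceT.
have mA : measurable (A : set mR) by exact: measurable_itv.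
have := (@integrable_mkcond _ mR R leb A (EFin \o (f' : R -> R)) mA).1 Ai.
apply: eq_integrable => // x _.
rewrite patchE; case: ifPn => // /negP xA; rewrite /= f'0 //.
rewrite ltNge; apply/negP => xM; apply: xA;
  rewrite inE /A /= in_itv /= -ler_norml.
by apply: le_trans xM _; rewrite (le_trans (ler_norm _)) // lerDl.
Qed.

Lemma Rintegral_deriv_itv (a b : R) : a < b ->
  \int[leb]_(x in `[a, b]) f' x = f b - f a.
Proof.
move=> ab; rewrite /Rintegral (continuous_FTC2 (F := f)) //.
- exact: continuous_subspaceT.
- split => [x _||]; first exact: (@df 0%N).
  + exact/cvg_at_right_filter/cf.
  + exact/cvg_at_left_filter/cf.
Qed.

(** The flag [c] selects [a <= x] or [a < x], to match both boundary conventions of [later]; the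
    choice affects the null set [{a}] only. *)
Lemma Rintegral_deriv_right (c : bool) (a : R) :
  \int[leb]_x (if a < x ?<= if c then f' x else 0) = - f a.
Proof.
(* [N] exceeds both [a] and [M]: the interval is nondegenerate, [f] vanishes at [N], and [f']
   vanishes beyond. *)
pose N := `|M| + `|a| + 1.
have aN : a < N.
  by apply: le_lt_trans (ler_norm a) _; rewrite /N addrAC ltr_pwDl // lerDr.
have MN : M < N.
  by apply: le_lt_trans (ler_norm M) _; rewrite /N -addrA ltrDl ltr_wpDl.
transitivity (\int[leb]_(x in `[a, N]) f' x); last first.
  by rewrite Rintegral_deriv_itv // f0 ?sub0r // (le_trans (ltW MN)) //
    ler_norm.
pose g := f' \_ `[a, N]; rewrite [RHS]Rintegral_mkcond -/g; congr fine.
apply: (@ae_eq_integral _ mR R leb setT (EFin \o g)) => //.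
- apply/measurable_EFinP; apply: measurable_fun_ifT => //.
    by case: c; [exact: measurable_fun_ler|exact: measurable_fun_ltr].
  exact: measurable_deriv.
- apply/measurable_EFinP.
  by apply/(measurable_restrict _ _ _).1 => //; apply: measurable_funTS;
    exact: measurable_deriv.
exists [set a]; split => //; first exact: lebesgue_measure_set1.
move=> x /= /not_implyP [_ xE]; apply: contrapT => /eqP xa; apply: xE.
congr EFin; rewrite /g patchE; have -> : (a < x ?<= if c) = (a < x).
  by case: c => //=; rewrite le_eqVlt eq_sym (negbTE xa).
rewrite mem_setE in_itv /= le_eqVlt eq_sym (negbTE xa) /=.
have [ax|//] := ltP a x; have [//|Nx] := leP x N.
by rewrite f'0 // (lt_le_trans MN) // (le_trans (ltW Nx)) // ler_norm.
Qed.

(** The integral of [f'] over the whole line is zero, so this is the complement of the right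
    half-line. *)
Lemma Rintegral_deriv_left (c : bool) (a : R) :
  \int[leb]_x (if a < x ?<= if c then 0 else f' x) = f a.
Proof.
have mc : measurable_fun (@setT mR) (fun x : mR => a < x ?<= if c).
  by case: c; [exact: measurable_fun_ler|exact: measurable_fun_ltr].
have ci : leb.-integrable setT
    (EFin \o (fun x : mR => if a < x ?<= if c then f' x else 0)).
  apply: le_integrable integrable_deriv => //.
    apply/measurable_EFinP; apply: measurable_fun_ifT => //.
    exact: measurable_deriv.
  by move=> x _ /=; case: ifP => //; rewrite normr0 lee_fin.
have <- : \int[leb]_x f' x - \int[leb]_x (if a < x ?<= if c then f' x else 0)
    = f a.
  rewrite Rintegral_deriv_right opprK;
    suff -> : \int[leb]_x f' x = 0 by rewrite add0r.
  (* The whole-line integral equals that over the half-line from [- (|M| + 1)], a point where [f] is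
     zero and left of which [f'] is zero. *)
  have M1 : M < `|- (`|M| + 1)|.
    by rewrite normrN ger0_norm ?addr_ge0 // (le_lt_trans (ler_norm M)) //
      ltrDl.
  rewrite -oppr0 -(f0 (ltW M1)) -(Rintegral_deriv_right false).
  apply: eq_Rintegral => x _ /=; have [//|xM] := ltP.
  rewrite f'0 // (lt_le_trans M1) // normrN ger0_norm ?addr_ge0 //.
  by rewrite lerNr in xM; rewrite (le_trans xM) // -normrN ler_norm.
rewrite -RintegralB //; last exact: integrable_deriv.
by apply: eq_Rintegral => x _; case: ifP; rewrite ?subrr ?subr0.
Qed.

End CompactSupport.

(** * Complex test functions and partial derivatives of their tensor products *)

Section TestFunctions.
Variable R : realType.
Local Notation C := R[i].
Local Notation mR := (measurableTypeR R).
Local Notation leb := (@lebesgue_measure R).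
Implicit Type phi : R -> C.

Lemma test_function_support phi : test_function phi ->
  exists M, forall x, M <= `|x| -> phi x = 0.
Proof.
(* [HM] bounds the support by any number greater than [M]. It is used with [M + 1], and [M + 2]
   leaves room for the non-strict inequality. *)
move=> [_ _ /compact_bounded[M [_ HM]]]; exists (M + 2) => x Mx.
apply: contrapT => /eqP x0.
have xc : closure [set y : R | phi y != 0] x by exact: subset_closure.
have := HM (M + 1); rewrite ltrDl ltr01 => /(_ isT x xc) /=.
by move/(le_trans Mx); rewrite lerD2l leNgt ltr1n.
Qed.

Lemma test_function_Re phi : test_function phi ->
  exists M,
    (forall n x, derivable (derive1n n (fun y => complex.Re (phi y) : R)) x 1) /\
    (forall x, M <= `|x| -> complex.Re (phi x) = 0).
Proof.
move=> tphi; have [M HM] := test_function_support tphi; exists M.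
by case: tphi => dr _ _; split => // x /HM ->.
Qed.

Lemma test_function_Im phi : test_function phi ->
  exists M,
    (forall n x, derivable (derive1n n (fun y => complex.Im (phi y) : R)) x 1) /\
    (forall x, M <= `|x| -> complex.Im (phi x) = 0).
Proof.
move=> tphi; have [M HM] := test_function_support tphi; exists M.
by case: tphi => _ di _; split => // x /HM ->.
Qed.

Lemma Cintegrable_Cderive phi : test_function phi ->
  Cintegrable leb (Cderive phi).
Proof.
move=> tphi; have [M [dr s]] := test_function_Re tphi.
have [M' [di s']] := test_function_Im tphi.
by split; [exact: (integrable_deriv dr s)|exact: (integrable_deriv di s')].
Qed.

Lemma Cmeasurable_test_function phi :
  test_function phi -> Cmeasurable (T := mR) phi.
Proof.
move=> tphi; have [_ [dr _]] := test_function_Re tphi.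
have [_ [di _]] := test_function_Im tphi.
split; apply: continuous_measurable_fun => x.
  by have /derivable1_diffP/differentiable_continuous := dr 0%N x.
by have /derivable1_diffP/differentiable_continuous := di 0%N x.
Qed.

Lemma Cintegral_Cderive_right phi (c : bool) (a : R) : test_function phi ->
  Cintegral leb (fun x => if a < x ?<= if c then Cderive phi x else 0) =
  - phi a.
Proof.
move=> tphi; have [M [dr s]] := test_function_Re tphi.
have [M' [di s']] := test_function_Im tphi.
rewrite /Cintegral [RHS](_ : _ = (- complex.Re (phi a)) +i* (- complex.Im (phi
  a))); last first.
  by case: (phi a).
rewrite -(Rintegral_deriv_right dr s c a) -(Rintegral_deriv_right di s' c a).
by congr (_ +i* _); apply: eq_Rintegral => x _; case: ifP.
Qed.

Lemma Cintegral_Cderive_left phi (c : bool) (a : R) : test_function phi ->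
  Cintegral leb (fun x => if a < x ?<= if c then 0 else Cderive phi x) = phi a.
Proof.
move=> tphi; have [M [dr s]] := test_function_Re tphi.
have [M' [di s']] := test_function_Im tphi.
rewrite /Cintegral [RHS](_ : _ = (complex.Re (phi a)) +i* (complex.Im (phi
  a))); last first.
  by case: (phi a).
rewrite -(Rintegral_deriv_left dr s c a) -(Rintegral_deriv_left di s' c a).
by congr (_ +i* _); apply: eq_Rintegral => x _; case: ifP.
Qed.

Lemma derive1_lincomb (u v : R -> R) (a b : R) x :
  derivable (derive1n 0 u) x 1 -> derivable (derive1n 0 v) x 1 ->
  derive1 (fun y => u y * a + v y * b) x = derive1 u x * a + derive1 v x * b.
Proof.
move=> /derivableP du /derivableP dv; rewrite !derive1E.
have -> : (fun y => u y * a + v y * b) = (a \*: u) + (b \*: v).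
  by apply/funext => y; rewrite /= [u y * a]mulrC [v y * b]mulrC.
rewrite (@derive_val _ _ _ _ _ _ _ (is_deriveD (is_deriveZ a du) (is_deriveZ b
  dv))).
by rewrite [RHS]addrC addrC [_ * a]mulrC [_ * b]mulrC.
Qed.

Lemma CderiveMr phi (z : C) x : test_function phi ->
  Cderive (fun s => phi s * z) x = Cderive phi x * z.
Proof.
move=> tphi; have [_ [dr _]] := test_function_Re tphi.
have [_ [di _]] := test_function_Im tphi.
case: z => a b; rewrite /Cderive -[RHS]/(_ +i* _).
congr (_ +i* _).
  rewrite -mulrN -(derive1_lincomb a (- b) (dr 0%N x) (di 0%N x)).
  by congr derive1; apply/funext => y; rewrite complex_ReM mulrN.
rewrite -(derive1_lincomb b a (dr 0%N x) (di 0%N x)).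
by congr derive1; apply/funext => y; rewrite complex_ImM.
Qed.

Lemma pderiv_tensor k (i : 'I_k) (phi : 'I_k -> R -> C) :
  test_function (phi i) -> pderiv i (tensor phi) =
  tensor (fun j => if j == i then Cderive (phi j) else phi j).
Proof.
move=> tphi; apply/funext => t; rewrite /pderiv /tensor.
(* [z] collects the factors that stay constant when the [i]-th variable moves. *)
pose z := \prod_(j < k | j != i) phi j (tnth t j).
rewrite (_ : (fun s => _) = fun s => phi i s * z); last first.
  apply/funext => s; rewrite (bigD1 i) //= tnth_mktuple eqxx; congr (_ * _).
  by apply: eq_bigr => j ji; rewrite tnth_mktuple (negbTE ji).
rewrite CderiveMr // (bigD1 i) //= eqxx; congr (_ * _).
by apply: eq_bigr => j ji; rewrite (negbTE ji).
Qed.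

(** Induction from the end of the list, since the last derivative of the distribution is the first
    to reach the test function. As [l] has no repetition, each factor is differentiated once and is
    still a test function at that moment. *)
Lemma foldl_distr_pderiv_tensor k (D : opdistr R k) (l : seq 'I_k)
    (phi : 'I_k -> R -> C) chi psi :
  uniq l -> (forall i, i \in l -> test_function (phi i)) ->
  foldl (@distr_pderiv R k) D l (tensor phi) chi psi =
  (-1) ^+ size l *
  D (tensor (fun j => if j \in l then Cderive (phi j) else phi j)) chi psi.
Proof.
elim/last_ind: l phi => [phi _ _|l i ih phi].
  by rewrite mul1r.
rewrite rcons_uniq => /andP[il ul] tl; rewrite foldl_rcons /distr_pderiv.
rewrite pderiv_tensor; last by apply: tl; rewrite mem_rcons mem_head.
rewrite ih // => [|j jl]; last first.
  by case: eqP => [ji|_]; [move: il; rewrite -ji jl|apply: tl;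
    rewrite mem_rcons inE jl orbT].
rewrite size_rcons exprS mulN1r mulNr; congr (- (_ * D (tensor _) _ _)).
apply/funext => j; rewrite mem_rcons inE.
by have [->|_] := eqVneq j i; rewrite ?(negbTE il).
Qed.

Lemma Tstar_tensor S k (phi : 'I_k -> R -> C) chi psi :
  (forall i, test_function (phi i)) ->
  Tstar S (tensor phi) chi psi =
  (-1) ^+ k * T_Q S (tensor (fun i => Cderive (phi i))) chi psi.
Proof.
move=> tphi; rewrite /Tstar foldl_distr_pderiv_tensor ?enum_uniq //.
rewrite -cardE card_ord.
have -> // : (fun j => if j \in enum 'I_k then Cderive (phi j) else phi j) =
  fun j => Cderive (phi j).
by apply/funext => j; rewrite mem_enum.
Qed.

End TestFunctions.

(** * Comparison of the two orderings *)

Section Orderings.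
Variables (R : realType) (S : 'M[R[i]]_2) (k : nat) (phi : 'I_k -> R -> R[i]).
Hypothesis tphi : forall i, test_function (phi i).
Variables (chi psi : wavefun R).
Hypotheses (chi2 : L2 chi) (psi2 : L2 psi).
Local Notation C := R[i].
Local Notation mR := (measurableTypeR R).
Local Notation leb := (@lebesgue_measure R).
Local Notation signs := {ffun 'I_k -> bool}.
Implicit Types (s : signs) (x t : R) (ts : k.-tuple mR).

Lemma measurable_later d (T : measurableType d) (f g : T -> R) :
  measurable_fun setT f -> measurable_fun setT g ->
  measurable_fun setT (fun z => later (f z) (g z)).
Proof.
move=> mf mg; have mNf : measurable_fun setT (fun z => - f z).
  exact: measurableT_comp (@oppr_measurable R setT) mf.
apply: measurable_fun_ifT; first exact: measurable_fun_ltr.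
  exact: measurable_fun_ltr.
exact: measurable_fun_ler.
Qed.

Lemma measurable_eqb d (T : measurableType d) (f : T -> bool) (b : bool) :
  measurable_fun setT f -> measurable_fun setT (fun z => f z == b).
Proof.
move=> mf; case: b; first by under eq_fun do rewrite eqb_id.
by under eq_fun do rewrite eqbF_neg; exact: measurable_neg.
Qed.

(** Uses the sign functions that index the expansion in [Ttilde]: [s i] true will correspond to I_+
    and false to I_-. *)
Definition later_pattern s (z : k.-tuple mR * mR) :=
  [forall i, later z.2 (tnth z.1 i) == s i].

Lemma measurable_later_pattern s : measurable_fun setT (later_pattern s).
Proof.
have -> : later_pattern s =
    fun z => \big[andb/true]_i (later z.2 (tnth z.1 i) == s i).
  by apply/funext => z; rewrite big_andE; exact: eq_forallb.
elim: (index_enum _) => [|i r ih].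
  by under eq_fun do rewrite big_nil; exact: measurable_cst.
under eq_fun do rewrite big_cons; apply: measurable_and => //.
apply/measurable_eqb/measurable_later; first exact: measurable_snd.
exact: (measurableT_comp (measurable_tnth _) measurable_fst).
Qed.

Definition ordered_product s x : 'M[C]_2 :=
  (\prod_(i < k | s i) Q_out S x) *m (\prod_(i < k | ~~ s i) Q_in S x).

Definition ordered_density s : mR -> C :=
  inner_density chi (fun x => ordered_product s x *m psi x).

Lemma Cintegrable_ordered_density s : Cintegrable leb (ordered_density s).
Proof. by apply: Cintegrable_inner => //; exact: L2_Q_out_in. Qed.

Lemma inner_time_ordered ts : inner chi (time_ordered (Qt S) ts psi) =
  Cintegral leb (fun x => \sum_s
    if later_pattern s (ts, x) then ordered_density s x else 0).
Proof.
have [l2 lE] := time_ordered_ae S ts psi2.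
pose psi' x := (\prod_(i < k | later x (tnth ts i)) Q_out S x) *m
    (\prod_(i < k | ~~ later x (tnth ts i)) Q_in S x) *m psi x.
pose f x := \sum_s if later_pattern s (ts, x) then ordered_density s x else 0.
have fi : Cintegrable leb f.
  apply: Cintegrable_sum => s; apply: Cintegrable_if.
    exact: (measurableT_comp (measurable_later_pattern s) (pair1_measurable
      ts)).
  exact: Cintegrable_ordered_density.
have fE x : f x = inner_density chi psi' x.
  (* For given times and position exactly one pattern holds, so the sum has a single surviving
     term. *)
  pose s0 : signs := [ffun i => later x (tnth ts i)].
  rewrite /f (bigD1 s0) //= big1 => [|s]; last first.
    case: ifP => // /forallP ps /eqP[]; apply/ffunP => i.
    by rewrite ffunE (eqP (ps i)).
  rewrite addr0 ifT; last by apply/forallP => i; rewrite ffunE.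
  rewrite /ordered_density /inner_density; apply: eq_bigr => i _.
  rewrite /psi' /ordered_product; congr (_ * (_ *m _ *m _) i 0);
    apply: eq_bigl => j.
    by rewrite ffunE.
  by rewrite ffunE.
apply: ae_eq_Cintegral.
- exact: Cintegrable_measurable (Cintegrable_inner chi2 l2).
- exact: Cintegrable_measurable fi.
- apply: lebesgue_aeS lE => x xE; rewrite -/(f x) fE /inner_density.
  by apply: eq_bigr => i _; rewrite xE.
Qed.

Let F s (z : k.-tuple mR * mR) : C :=
  if later_pattern s z
  then tensor (fun i => Cderive (phi i)) z.1 * ordered_density s z.2 else 0.

Let Cintegrable_F :
  Cintegrable (lebesgue_tuple R k \x leb)%E (fun z => \sum_s F s z).
Proof.
apply: Cintegrable_sum => s; apply: Cintegrable_if.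
  exact: measurable_later_pattern.
apply: Cintegrable_prodM; last exact: Cintegrable_ordered_density.
by apply: (Cintegrable_tensor _).1 => i; exact: Cintegrable_Cderive.
Qed.

(** A single integral over times and position, from which the times can be integrated out first. *)
Lemma T_Q_Fubini : T_Q S (tensor (fun i => Cderive (phi i))) chi psi =
  Cintegral (lebesgue_tuple R k \x leb)%E (fun z => \sum_s F s z).
Proof.
rewrite -Cintegral12_prod_meas //; apply: eq_Cintegral => ts.
rewrite inner_time_ordered -CintegralZ; last first.
  apply: Cintegrable_sum => s; apply: Cintegrable_if.
    exact: (measurableT_comp (measurable_later_pattern s) (pair1_measurable
      ts)).
  exact: Cintegrable_ordered_density.
apply: eq_Cintegral => x; rewrite mulr_sumr; apply: eq_bigr => s _.
by rewrite /F /=; case: ifP; rewrite ?mulr0.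
Qed.

Lemma Cintegral_later i (b : bool) x :
  Cintegral leb (fun t => if later x t == b then Cderive (phi i) t else 0) =
  if b then - phi i (- x) else phi i (- x).
Proof.
case: b.
  (* The comparison in [later] is strict exactly when [x < 0], which fixes the flag. *)
  rewrite -(Cintegral_Cderive_right (~~ (x < 0)) (- x) (tphi i)).
  by apply: eq_Cintegral => t; rewrite eqb_id /later; case: (x < 0).
rewrite -(Cintegral_Cderive_left (~~ (x < 0)) (- x) (tphi i)).
by apply: eq_Cintegral => t; rewrite eqbF_neg if_neg /later; case: (x < 0).
Qed.

(** For fixed [x] the indicator of a pattern is a product of indicators in the separate times, so
    the integrand is again a tensor product. *)
Lemma Cintegral_F s x :
  Cintegrable (lebesgue_tuple R k) (fun ts => F s (ts, x)) /\
  Cintegral (lebesgue_tuple R k) (fun ts => F s (ts, x)) =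
  ordered_density s x *
  \prod_(i < k) (if s i then - phi i (- x) else phi i (- x)).
Proof.
pose f i t := if later x t == s i then Cderive (phi i) t else 0.
have fi i : Cintegrable leb (f i).
  apply: Cintegrable_if; last exact: Cintegrable_Cderive.
  by apply/measurable_eqb/measurable_later => //; exact: measurable_id.
have [tfi tfE] := Cintegrable_tensor fi.
have FE : (fun ts => F s (ts, x)) = fun ts => ordered_density s x * tensor f ts.
  apply/funext => ts; rewrite /F /=; case: ifPn => [/forallP p|].
    rewrite mulrC; congr (_ * _); apply: eq_bigr => i _.
    by rewrite /f (p i).
  rewrite negb_forall => /existsP[i /negbTE pi].
  by rewrite /tensor (bigD1 i) //= /f pi mul0r mulr0.
rewrite FE; split; first exact: CintegrableZ.
rewrite CintegralZ // tfE; congr (_ * _); apply: eq_bigr => i _.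
exact: Cintegral_later.
Qed.

(** The common density in [x] to which both sides of the theorem are reduced. *)
Definition Ttilde_density x : C := \sum_s ordered_density s x *
  \prod_(i < k) (if s i then phi i (- x) else - phi i (- x)).

Lemma Tstar_density : Tstar S (tensor phi) chi psi = Cintegral leb
  Ttilde_density.
Proof.
rewrite Tstar_tensor // T_Q_Fubini -CintegralZ // -Cintegral21_prod_meas;
  last first.
  exact: CintegrableZ.
apply: eq_Cintegral => x.
rewrite CintegralZ; last by apply: Cintegrable_sum => s;
  exact: (Cintegral_F s x).1.
rewrite Cintegral_sum; last by move=> s; exact: (Cintegral_F s x).1.
rewrite mulr_sumr; apply: eq_bigr => s _; rewrite (Cintegral_F s x).2 mulrCA.
(* The sign [(-1) ^+ k] is spread as one factor -1 per index, which exchanges the signs attached to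
   I_+ and I_-. *)
congr (_ * _); rewrite -[X in _ ^+ X]card_ord -prodr_const -big_split /=.
by apply: eq_bigr => i _; rewrite mulN1r; case: ifP; rewrite ?opprK.
Qed.

Lemma Cmeasurable_density : Cmeasurable (T := mR) Ttilde_density.
Proof.
rewrite /Ttilde_density; elim: (index_enum _) => [|s r ih].
  by under eq_fun do rewrite big_nil; split; exact: measurable_cst.
under eq_fun do rewrite big_cons; apply: CmeasurableD => //;
  apply: CmeasurableM.
  exact: Cintegrable_measurable (Cintegrable_ordered_density s).
elim: (index_enum _) => [|i l ihl].
  by under eq_fun do rewrite big_nil; split; exact: measurable_cst.
under eq_fun do rewrite big_cons; apply: CmeasurableM => //.
have mN : measurable_fun (@setT mR) (fun x : mR => - (x : R) : mR).
  exact: (@oppr_measurable R setT).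
have [mr mi] := Cmeasurable_comp (Cmeasurable_test_function (tphi i)) mN.
case: (s i) => //; split.
  rewrite (_ : (fun x => _) = fun x => - complex.Re (phi i (- x))).
    exact: measurableT_comp mr.
  by apply/funext => x; case: (phi i (- x)).
rewrite (_ : (fun x => _) = fun x => - complex.Im (phi i (- x))).
  exact: measurableT_comp mi.
by apply/funext => x; case: (phi i (- x)).
Qed.

Lemma big_comp_Mult I (r : seq I) (P : pred I) (m : I -> R -> 'M[C]_2) psi' x :
  (\big[@comp _ _ _/id]_(i <- r | P i) Mult (m i)) psi' x =
  (\prod_(i <- r | P i) m i x) *m psi' x.
Proof.
elim: r => [|i r ih]; first by rewrite !big_nil mul1mx.
by rewrite !big_cons; case: (P i) => //=; rewrite /Mult ih mulmxA.
Qed.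

(** The point 0 is excluded because both indicators in [Iplus] and [Iminus] vanish there, whereas
    [Q_out] and [Q_in] equal [Q]. *)
Lemma Ttilde_ordered x : x != 0 -> inner_density chi (Ttilde S phi psi) x =
  Ttilde_density x.
Proof.
move=> x0.
have outE : (x < 0)%R%:R *: SQ S + (0 < x)%R%:R *: Qmx R = Q_out S x.
  rewrite /Q_out; case: ltgtP x0 => //= _ _.
    by rewrite scale1r scale0r addr0.
  by rewrite scale1r scale0r add0r.
have inE : (x < 0)%R%:R *: Qmx R + (0 < x)%R%:R *: QS S = Q_in S x.
  rewrite /Q_in; case: ltgtP x0 => //= _ _.
    by rewrite scale1r scale0r addr0.
  by rewrite scale1r scale0r add0r.
pose c s := \prod_(i < k) (if s i then phi i (- x) else - phi i (- x)).
have TE : Ttilde S phi psi x = \sum_s c s *: (ordered_product s x *m psi x).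
  apply: eq_bigr => s _; rewrite /= !big_comp_Mult.
  under eq_bigr do rewrite outE.
  under [X in _ *m (X *m _)]eq_bigr do rewrite inE -scaleNr.
  rewrite !scaler_prod mulmxA -scalemxAl -scalemxAr scalerA -scalemxAl.
  (* The scalar product over all indices splits into the I_+ indices and the I_- indices. *)
  congr (_ *: _); rewrite /c [RHS](bigID (fun i => s i)) /=; congr (_ * _).
    by apply: eq_bigr => i ->.
  by apply: eq_bigr => i /negbTE ->.
rewrite /inner_density; under eq_bigr do rewrite TE summxE mulr_sumr.
rewrite exchange_big /=; apply: eq_bigr => s _.
rewrite /ordered_density /inner_density mulr_suml; apply: eq_bigr => i _.
by rewrite [in LHS]mxE mulrCA mulrC.
Qed.

Lemma Cintegral_Ttilde : inner chi (Ttilde S phi psi) = Cintegral leb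
  Ttilde_density.
Proof.
pose g := inner_density chi (Ttilde S phi psi).
(* Gluing in the value at 0 makes [g] visibly measurable, as comparison of integrals up to null sets
   requires. *)
have gE : g = fun x => if x == 0 then g 0 else Ttilde_density x.
  by apply/funext => x; have [->|x0] := eqVneq x 0; [|exact: Ttilde_ordered].
have [mr mi] := Cmeasurable_density.
have m0 : measurable_fun setT (fun x : mR => (x : R) == 0).
  by under eq_fun do rewrite eq_le; apply: measurable_and;
    exact: measurable_fun_ler.
apply: ae_eq_Cintegral => //.
  rewrite -[X in Cmeasurable X]/g gE; split.
    by under eq_fun do rewrite (fun_if (@complex.Re R));
      exact: measurable_fun_ifT.
  by under eq_fun do rewrite (fun_if (@complex.Im R));
    exact: measurable_fun_ifT.
exists [set 0]; split => //; first exact: lebesgue_measure_set1.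
move=> x /= xE; apply: contrapT => /eqP x0; apply: xE; exact: Ttilde_ordered.
Qed.

End Orderings.

Theorem proposition3 (R : realType) (S : 'M[R[i]]_2) (hS : S \is unitarymx)
    (k : nat) (hk : (1 <= k)%N)
    (phi : 'I_k -> R -> R[i]) (hphi : forall i, test_function (phi i))
    (chi psi : R -> 'cV[R[i]]_2) (hchi : L2 chi) (hpsi : L2 psi) :
  Tstar S (tensor phi) chi psi = inner chi (Ttilde S phi psi).
Proof. by rewrite Tstar_density // Cintegral_Ttilde. Qed.
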